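(* In the randomized-experiment setting described in the context, suppose $p_{\min}\in(0,1/2]$, $P_t\in[p_{\min},1-p_{\min}]$ a.s., $Y_t(k)\in[0,1]$ and $\widehat Y_t(k)\in[0,1]$ for all $t\ge1$, $k=0,1$. Let $\alpha\in(0,1)$ and let $u$ be any sub-exponential uniform boundary with scale $2/p_{\min}$ and crossing probability $\alpha$. Then $$\mathbb{P}\left(\forall t\ge1:\ \left|\overline X_t-\mathrm{ATE}_t\right|<\frac{u(V_t)}{t}\right)\ge1-2\alpha.$$
   Context: Setting. For each unit $t\in\mathbb{N}$, $Y_t(0),Y_t(1)$ are fixed (nonrandom) real potential outcomes. $(\mathcal F_t)_{t=0}^\infty$ is a filtration; $Z_t$ is a $\{0,1\}$-valued $\mathcal F_t$-measurable treatment indicator; $P_t=\mathbb{E}[Z_t\mid\mathcal F_{t-1}]$ with $0<P_t<1$ a.s.; the observed outcome is $Y_t^{\mathrm{obs}}=Y_t(Z_t)$. The predictions $\widehat Y_t(0),\widehat Y_t(1)$ are $\mathcal F_{t-1}$-measurable random variables. The estimand is $\mathrm{ATE}_t=t^{-1}\sum_{i=1}^t[Y_i(1)-Y_i(0)]$. Define $$X_t=\widehat Y_t(1)-\widehat Y_t(0)+\frac{Z_t-P_t}{P_t(1-P_t)}\left(Y_t^{\mathrm{obs}}-\widehat Y_t(Z_t)\right),\qquad \overline X_t=\frac1t\sum_{i=1}^tX_i,$$ $$V_t=\sum_{i=1}^t\left(\frac{Z_i-P_i}{P_i(1-P_i)}\right)^2\left(Y_i^{\mathrm{obs}}-\widehat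 Y_i(Z_i)\right)^2.$$ Sub-$\psi$ condition: let $(S_t)_{t=0}^\infty$, $(V_t)_{t=0}^\infty$ be real-valued processes adapted to a filtration $(\mathcal F_t)_{t=0}^\infty$ with $S_0=V_0=0$ and $V_t\ge 0$ for all $t$. For $\psi:[0,\lambda_{\max})\to\mathbb{R}$ and $l_0\in[1,\infty)$, $(S_t)$ is $l_0$-sub-$\psi$ with variance process $(V_t)$ if for each $\lambda\in[0,\lambda_{\max})$ there is a supermartingale $(L_t(\lambda))_{t=0}^\infty$ with respect to $(\mathcal F_t)$ with $\mathbb{E}L_0(\lambda)\le l_0$ and $\exp\{\lambda S_t-\psi(\lambda)V_t\}\le L_t(\lambda)$ a.s. for all $t$. Uniform boundary: $u$ is an $l_0$-sub-$\psi$ uniform boundary with crossing probability $\alpha$ if $\mathbb{P}(\exists t\ge 1: S_t\ge u(V_t))\le\alpha$ for every pair $(S_t,V_t)$ such that $(S_t)$ is $l_0$-sub-$\psi$ with variance process $(V_t)$. A sub-exponential uniform boundary with scale $c>0$ is an $l_0$-sub-$\psi$ uniform boundary with $\psi(\lambda)=\psi_{E,c}(\lambda)=c^{-2}(-\log(1-c\lambda)-c\lambda)$ on $0\le\lambda<1/c$; here, the process being scalar, $l_0=1$. *)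

(* Defs.v *)
From HB Require Import structures.
From mathcomp Require Import all_boot all_order all_algebra.
From mathcomp Require Import all_classical all_reals all_analysis.

Set Implicit Arguments.
Unset Strict Implicit.
Unset Printing Implicit Defensive.

Import Order.TTheory GRing.Theory Num.Theory.
Import numFieldNormedType.Exports.

Local Open Scope classical_set_scope.
Local Open Scope ring_scope.

Section Processes.
Context (d : measure_display) (T : measurableType d) (R : realType).

(* Intended for a sigma-algebra [G] on [T], where [<<s G>>] is [G] itself. *)
Definition measurable_wrt (d' : measure_display) (T' : measurableType d')
    (G : set (set T)) (f : T -> T') : Prop :=
  measurable_fun [set: g_sigma_algebraType G]
    (f : g_sigma_algebraType G -> T').

Definition filtration (F : nat -> set (set T)) : Prop :=
  [/\ forall t, sigma_algebra [set: T] (F t),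
      forall t, F t `<=` d.-measurable &
      forall s t, (s <= t)%N -> F s `<=` F t].

Definition adapted (F : nat -> set (set T)) (X : nat -> T -> R) : Prop :=
  forall t, measurable_wrt (F t) (X t).

(* [C] is a version of the conditional expectation of the (integrable) random
   variable [X] given the sub-sigma-algebra [G]. *)
Definition is_cond_exp (P : probability T R) (G : set (set T))
    (X C : T -> R) : Prop :=
  [/\ measurable_wrt G C,
      P.-integrable [set: T] (EFin \o C) &
      forall A, G A ->
        (\int[P]_(w in A) (C w)%:E = \int[P]_(w in A) (X w)%:E)%E].

Definition supermartingale (P : probability T R) (F : nat -> set (set T))
    (L : nat -> T -> R) : Prop :=
  [/\ adapted F L,
      forall t, P.-integrable [set: T] (EFin \o L t) &
      forall t, exists C : T -> R,
        is_cond_exp P (F t) (L t.+1) C /\ {ae P, forall w, C w <= L t w}].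

(* [psi] is only used on [0, lmax); [lmax] may be [+oo]. *)
Definition sub_psi (P : probability T R) (F : nat -> set (set T))
    (lmax : \bar R) (psi : R -> R) (l0 : R) (S V : nat -> T -> R) : Prop :=
  [/\ adapted F S, adapted F V,
      forall w, S 0%N w = 0 /\ V 0%N w = 0,
      forall t w, 0 <= V t w &
      forall lambda : R, 0 <= lambda -> (lambda%:E < lmax)%E ->
        exists L : nat -> T -> R,
          [/\ supermartingale P F L,
              ('E_P[L 0%N] <= l0%:E)%E &
              forall t, {ae P, forall w,
                expR (lambda * S t w - psi lambda * V t w) <= L t w}]].

End Processes.

(* A property of [u] alone: the processes range over all filtered probability
   spaces. Since a measure takes junk values on non-measurable sets,
   measurability of [u] on the range [0, +oo) of the variance processes is
   required, so that the crossing event is an event. *)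
Definition uniform_boundary (R : realType) (lmax : \bar R) (psi : R -> R)
    (l0 alpha : R) (u : R -> R) : Prop :=
  measurable_fun (`[0, +oo[ : set R) u /\
  forall (d : measure_display) (T : measurableType d) (P : probability T R)
    (F : nat -> set (set T)) (S V : nat -> T -> R),
    filtration F -> sub_psi P F lmax psi l0 S V ->
    (P [set w | exists t, (1 <= t)%N /\ (u (V t w) <= S t w)%R]
       <= alpha%:E)%E.

Definition psiE (R : realType) (c lambda : R) : R :=
  (- ln (1 - c * lambda) - c * lambda) / c ^+ 2.

Definition sub_exponential_boundary (R : realType) (c alpha : R)
    (u : R -> R) : Prop :=
  0 < c /\ uniform_boundary (c^-1)%:E (psiE c) 1 alpha u.

(* Units are numbered from 1; values at index 0 are never used. The treatment
   indicator [Z] is [bool]-valued, so [Y t (Z t w)] is the observed outcome and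
   [(Z t w)%:R] the indicator as a real number. *)
Section Experiment.
Context (T : Type) (R : realType).
Variables (Y : nat -> bool -> R) (Z : nat -> T -> bool) (p : nat -> T -> R)
  (Yhat : nat -> bool -> T -> R).

Definition ATE (t : nat) : R :=
  (t%:R)^-1 * \sum_(1 <= i < t.+1) (Y i true - Y i false).

Definition Yobs (t : nat) (w : T) : R := Y t (Z t w).

Definition ipw (t : nat) (w : T) : R :=
  ((Z t w)%:R - p t w) / (p t w * (1 - p t w)).

Definition effect_estimate (t : nat) (w : T) : R :=
  Yhat t true w - Yhat t false w
  + ipw t w * (Yobs t w - Yhat t (Z t w) w).

Definition mean_estimate (t : nat) (w : T) : R :=
  (t%:R)^-1 * \sum_(1 <= i < t.+1) effect_estimate i w.

Definition variance_process (t : nat) (w : T) : R :=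
  \sum_(1 <= i < t.+1) ipw i w ^+ 2 * (Yobs i w - Yhat i (Z i w) w) ^+ 2.

End Experiment.

(* Main.v *)
(* Let S_t be the sum of the errors X_i - (Y_i(1) - Y_i(0)).  Each of them is
   W_i - E[W_i | F_(i-1)], where W_i is the inverse-probability-weighted
   residual, whose square is the increment of V and which satisfies
   |W_i| <= 1 / pmin <= c.  From exp(l x - psi(l) x^2) <= 1 + l x for x >= - c
   it follows that exp(l S_t - psi(l) V_t) is a supermartingale, and likewise
   for - S_t; the theorem is the union bound over the two crossing events. *)
Require Import Defs.
From HB Require Import structures.
From mathcomp Require Import all_boot all_order all_algebra.
From mathcomp Require Import all_classical all_reals all_analysis.
From mathcomp Require Import measurable_realfun ring lra.

Set Implicit Arguments.
Unset Strict Implicit.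
Unset Printing Implicit Defensive.

Import Order.TTheory GRing.Theory Num.Theory.
Import numFieldNormedType.Exports.

Local Open Scope classical_set_scope.
Local Open Scope ring_scope.

(** * Measurability with respect to a sub-sigma-algebra *)

Lemma measurable_fun_invr (R : realType) :
  measurable_fun [set: R] (@GRing.inv R).
Proof.
(* Inversion is not continuous at [0]. In this product the real power gives the reciprocal of the
   square, and the factor [x] restores the sign and the default value [0] at [0]. *)
have -> : @GRing.inv R = (fun x => x * (x ^+ 2) `^ (-1)).
  apply/funext => x; rewrite powR_inv1 ?sqr_ge0//.
  have [->|x0] := eqVneq x 0; first by rewrite invr0 mul0r.
  by rewrite expr2 invfM mulrA divff// mul1r.
apply: measurable_funM => //.
apply: (@measurableT_comp _ _ _ _ _ _ (fun y : R => y `^ (-1)) _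
  (fun x : R => x ^+ 2)); first exact: measurable_powR.
exact: exprn_measurable.
Qed.

Section measurable_wrt.
Context (d : measure_display) (T : measurableType d).

Lemma measurable_wrtP (d' : measure_display) (T' : measurableType d')
    (G : set (set T)) (f : T -> T') : sigma_algebra [set: T] G ->
  measurable_wrt G f <-> (forall B, measurable B -> G (f @^-1` B)).
Proof.
move=> sG; have GE : <<s G >> = G by exact: sigma_algebra_id.
split=> [mf B mB|mf _ B mB].
  by have := mf measurableT B mB; rewrite setTI /measurable/= GE.
by rewrite setTI /measurable/= GE; exact: mf.
Qed.

Lemma measurable_wrt_sub (d' : measure_display) (T' : measurableType d')
    (G G' : set (set T)) (f : T -> T') :
  sigma_algebra [set: T] G -> sigma_algebra [set: T] G' -> G `<=` G' ->
  measurable_wrt G f -> measurable_wrt G' f.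
Proof.
move=> sG sG' GG' /measurable_wrtP mf; apply/measurable_wrtP => // B mB.
exact/GG'/mf.
Qed.

Lemma measurable_wrt_measurable (d' : measure_display)
    (T' : measurableType d') (G : set (set T)) (f : T -> T') :
  sigma_algebra [set: T] G -> G `<=` d.-measurable ->
  measurable_wrt G f -> measurable_fun [set: T] f.
Proof.
move=> sG Gm /measurable_wrtP mf _ B mB; rewrite setTI.
exact/Gm/mf.
Qed.

(** Meant for [b] the treatment: each fixed arm [f k] is known one step earlier, and only the
    selection of the arm is new information. *)
Lemma measurable_wrt_if (R : realType) (G : set (set T)) (b : T -> bool)
    (f : bool -> T -> R) :
  measurable_wrt G b -> (forall k, measurable_wrt G (f k)) ->
  measurable_wrt G (fun w => f (b w) w).
Proof.
move=> mb mf; rewrite /measurable_wrt.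
rewrite (_ : (fun w => _) = (fun w => if b w then f true w else f false w)).
  by apply: measurable_fun_ifT => //; exact: mf.
by apply/funext => w; case: (b w).
Qed.

End measurable_wrt.

(** * Taking a measurable factor out of a conditional expectation *)

Section take_out.
Context (d : measure_display) (T : measurableType d) (R : realType)
  (P : {measure set T -> \bar R}).
Import HBNNSimple.

(** The level sets of [h] belong to [G], so the integral depends on [f] only through its integrals
    over members of [G]. *)
Lemma integral_mul_nnsfun (G : set (set T))
    (h : {nnsfun (g_sigma_algebraType G) >-> R}) (f : T -> R) (A : set T) :
  sigma_algebra [set: T] G -> G `<=` d.-measurable -> G A ->
  measurable_fun [set: T] f -> (forall w, 0 <= f w) ->
  (\int[P]_(w in A) ((h w)%:E * (f w)%:E) =
   \sum_(y \in range h) y%:E * \int[P]_(w in A `&` h @^-1` [set y]) (f w)%:E)%E.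
Proof.
move=> sG Gm GA mf f0.
have GE : <<s G >> = G by exact: sigma_algebra_id.
have Gh y : G (h @^-1` [set y]).
  have : measurable (h @^-1` [set y]) by exact: measurable_sfunP.
  by rewrite /measurable/= GE.
have mind y : measurable_fun A (fun w : T => \1_(h @^-1` [set y]) w : R).
  by apply: measurable_indic; exact/Gm/Gh.
have mfA : measurable_fun A f by exact: measurable_funTS.
have mA := Gm _ GA.
transitivity (\int[P]_(w in A) (\sum_(y \in range h)
    ((y * \1_(h @^-1` [set y]) w)%:E * (f w)%:E)))%E.
  apply: eq_integral => w _.
  rewrite -ge0_mule_fsuml => [|y]; last exact: nnfun_muleindic_ge0.
  rewrite fsumEFin //; congr (_%:E * _)%E; exact: (fimfunE h w).
rewrite ge0_integral_fsum//; last 2 first.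
- move=> y; apply/measurable_EFinP; apply: measurable_funM => //.
  exact: measurable_funM.
- by move=> y w _; apply: mule_ge0; [exact: nnfun_muleindic_ge0|rewrite lee_fin].
apply: eq_fsbigr => y /[!inE] -[w0 _ <-].
set r := h w0; have r0 : 0 <= r by [].
under eq_integral do rewrite EFinM -muleA.
rewrite ge0_integralZl_EFin//; last 2 first.
- by move=> w _; rewrite mule_ge0// lee_fin.
- by apply/measurable_EFinP; exact: measurable_funM.
congr (_ * _)%E.
rewrite integral_mkcondr; apply: eq_integral => w _.
by rewrite muleC epatch_indic.
Qed.

(** For simple [H] this is the level-set expansion; the general case follows by monotone
    convergence. With nonnegative functions both sides make sense in the extended reals, whether or
    not they are finite. *)
Lemma integral_mul_sub (G : set (set T)) (H f g : T -> R) (A : set T) :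
  sigma_algebra [set: T] G -> G `<=` d.-measurable ->
  measurable_wrt G H -> (forall w, 0 <= H w) ->
  measurable_fun [set: T] f -> (forall w, 0 <= f w) ->
  measurable_fun [set: T] g -> (forall w, 0 <= g w) ->
  (forall B, G B ->
     \int[P]_(w in B) (f w)%:E = \int[P]_(w in B) (g w)%:E)%E ->
  G A ->
  (\int[P]_(w in A) (H w * f w)%:E = \int[P]_(w in A) (H w * g w)%:E)%E.
Proof.
move=> sG Gm mH H0 mf f0 mg g0 fg GA.
have mA := Gm _ GA.
have GI B C : G B -> G C -> G (B `&` C).
  have GE : @measurable _ (g_sigma_algebraType G) = G.
    exact: sigma_algebra_id.
  by rewrite -GE; exact: measurableI.
(* [H] is approximated on the space carrying [G] itself, so that the level sets of the simple
   functions are in [G] and not merely measurable. *)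
have mH' : measurable_fun [set: g_sigma_algebraType G]
    (EFin \o (H : g_sigma_algebraType G -> R)).
  exact/measurable_EFinP.
pose h := nnsfun_approx (@measurableT _ (g_sigma_algebraType G)) mH'.
have lim_h (k : T -> R) : measurable_fun [set: T] k -> (forall w, 0 <= k w) ->
  (\int[P]_(w in A) (H w * k w)%:E =
   limn (fun n => \int[P]_(w in A) ((h n w)%:E * (k w)%:E)))%E.
  move=> mk k0.
  have hk w : ((H w * k w)%:E = limn (fun n => (h n w)%:E * (k w)%:E))%E.
    apply/esym/cvg_lim => //; rewrite EFinM; apply: cvgeZr => //.
    apply: (cvg_nnsfun_approx measurableT mH') => // x _; exact: H0.
  under eq_integral do rewrite hk.
  apply: monotone_convergence => //.
  - move=> n; apply/measurable_EFinP; apply: measurable_funM.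
      apply: measurable_funTS.
      apply: (@measurable_wrt_measurable _ _ _ _ G) => //.
      exact: measurable_funP.
    exact: measurable_funTS.
  - by move=> n w _; rewrite -EFinM lee_fin mulr_ge0.
  - move=> w _ m n mn; rewrite -!EFinM lee_fin ler_wpM2r//.
    have /lefP hmn := nd_nnsfun_approx measurableT mH' mn; exact: hmn.
rewrite !lim_h//; congr (limn _); apply/funext => n.
rewrite !(@integral_mul_nnsfun G)//; apply: eq_fsbigr => y _.
congr (_ * _)%E; apply: fg; apply: GI => //.
have : measurable (h n @^-1` [set y]) by exact: measurable_sfunP.
by rewrite /measurable/= sigma_algebra_id.
Qed.

End take_out.

(** * Adapted sums and products *)

Section adapted.
Context (d : measure_display) (T : measurableType d) (R : realType).
Variable F : nat -> set (set T).
Hypothesis hF : filtration F.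

Lemma filtration_measurable (d' : measure_display) (T' : measurableType d')
    (t : nat) (f : T -> T') :
  measurable_wrt (F t) f -> measurable_fun [set: T] f.
Proof. by case: hF => sF Fm _; exact: measurable_wrt_measurable. Qed.

Lemma filtration_wrt_le (d' : measure_display) (T' : measurableType d')
    (s t : nat) (f : T -> T') : (s <= t)%N ->
  measurable_wrt (F s) f -> measurable_wrt (F t) f.
Proof. by case: hF => sF _ Fle st; apply: measurable_wrt_sub => //; exact: Fle. Qed.

Lemma adapted_sum (D : nat -> T -> R) :
  (forall t, (1 <= t)%N -> measurable_wrt (F t) (D t)) ->
  adapted F (fun t w => \sum_(1 <= i < t.+1) D i w).
Proof.
move=> mD; elim=> [|t IH].
  under eq_fun do rewrite big_geq//.
  exact: measurable_cst.
under eq_fun do rewrite big_nat_recr//=.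
by apply: measurable_funD; [exact: (filtration_wrt_le (leqnSn t))|exact: mD].
Qed.

Lemma adapted_prod (D : nat -> T -> R) :
  (forall t, (1 <= t)%N -> measurable_wrt (F t) (D t)) ->
  adapted F (fun t w => \prod_(1 <= i < t.+1) D i w).
Proof.
move=> mD; elim=> [|t IH].
  under eq_fun do rewrite big_geq//.
  exact: measurable_cst.
under eq_fun do rewrite big_nat_recr//=.
by apply: measurable_funM; [exact: (filtration_wrt_le (leqnSn t))|exact: mD].
Qed.

End adapted.

(** * Product supermartingales driven by a binary treatment *)

Section supermartingale_prod.
Context (d : measure_display) (T : measurableType d) (R : realType)
  (P : probability T R).
Variables (F : nat -> set (set T)) (Z : nat -> T -> bool) (p : nat -> T -> R)
  (a : nat -> bool -> T -> R).
Hypothesis hF : filtration F.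
Hypothesis hZ : forall t, (1 <= t)%N -> measurable_wrt (F t) (Z t).
Hypothesis hp : forall t, (1 <= t)%N ->
  is_cond_exp P (F t.-1) (fun w => (Z t w)%:R) (p t).
Hypothesis p01 : forall t w, (1 <= t)%N -> 0 <= p t w <= 1.
Hypothesis ma : forall t k, (1 <= t)%N -> measurable_wrt (F t.-1) (a t k).
Hypothesis a_ge0 : forall t k w, (1 <= t)%N -> 0 <= a t k w.
Hypothesis a_le1 : forall t w, (1 <= t)%N ->
  p t w * a t true w + (1 - p t w) * a t false w <= 1.

Let L t w := \prod_(1 <= i < t.+1) a i (Z i w) w.
(* As [Z] is binary, the conditional expectation of [L t.+1] is explicit. *)
Let C t w :=
  L t w * (p t.+1 w * a t.+1 true w + (1 - p t.+1 w) * a t.+1 false w).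

Let LS t w : L t.+1 w = L t w * a t.+1 (Z t.+1 w) w.
Proof. by rewrite /L big_nat_recr. Qed.

Let L_ge0 t w : 0 <= L t w.
Proof. by rewrite /L big_nat; apply: prodr_ge0 => i /andP[i1 _]; exact: a_ge0. Qed.

Let C_ge0 t w : 0 <= C t w.
Proof.
have /andP[p0 p1] := p01 w (ltn0Sn t).
by rewrite mulr_ge0// addr_ge0// mulr_ge0 ?a_ge0// subr_ge0.
Qed.

Let C_le t w : C t w <= L t w.
Proof. by rewrite -[leRHS]mulr1 ler_wpM2l// a_le1. Qed.

Let mL : adapted F L.
Proof.
apply: adapted_prod => // t t1; apply: measurable_wrt_if; first exact: hZ.
by move=> k; apply: filtration_wrt_le (ma k t1) => //; exact: leq_pred.
Qed.

Let mp t : measurable_wrt (F t) (p t.+1).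
Proof. by have [] := hp (ltn0Sn t). Qed.

Let mC t : measurable_wrt (F t) (C t).
Proof.
apply: measurable_funM; first exact: mL.
apply: measurable_funD; apply: measurable_funM.
- exact: mp.
- exact: (ma true (ltn0Sn t)).
- apply: measurable_funB; [exact: measurable_cst|exact: mp].
- exact: (ma false (ltn0Sn t)).
Qed.

Let mpT t : measurable_fun [set: T] (p t.+1).
Proof. exact: (filtration_measurable hF (@mp t)). Qed.

Let mZT t : measurable_fun [set: T] (fun w => (Z t.+1 w)%:R : R).
Proof.
rewrite (_ : (fun w => _) = fun w => if Z t.+1 w then 1 else 0).
  apply: measurable_fun_ifT => //.
  exact: (filtration_measurable hF (hZ (ltn0Sn t))).
by apply/funext => w; case: (Z _ _).
Qed.

Let integral_compl t B : F t B ->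
  (\int[P]_(w in B) (1 - (Z t.+1 w)%:R)%:E =
   \int[P]_(w in B) (1 - p t.+1 w)%:E)%E.
Proof.
move=> FB; have [_ pint pE] := hp (ltn0Sn t).
have [_ Fm _] := hF; have mB := Fm _ _ FB.
(* Splitting the integral of a difference requires integrable terms; the constant [1] is integrable
   and dominates the indicator. *)
have i1 : P.-integrable B (EFin \o cst (1 : R)).
  exact: finite_measure_integrable_cst.
under eq_integral do rewrite EFinB.
under [RHS]eq_integral do rewrite EFinB.
rewrite (integralB_EFin mB i1) ?(integralB_EFin mB i1).
- by rewrite pE.
- exact: (integrableS measurableT).
- apply: (le_integrable mB _ _ i1).
    by apply/measurable_EFinP; exact: measurable_funTS.
  by move=> w _ /=; rewrite lee_fin normr1; case: (Z _ _); rewrite ?normr1 ?normr0.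
Qed.

(** [L t.+1] is [H true] times the treatment indicator plus [H false] times its complement. Both
    coefficients are known at time [t], so the indicator may be replaced by [p t.+1] under the
    integral. *)
Let integral_C t A : F t A ->
  (\int[P]_(w in A) (C t w)%:E = \int[P]_(w in A) (L t.+1 w)%:E)%E.
Proof.
move=> FA; have [sF Fm _] := hF; have mA := Fm _ _ FA.
have t1 := ltn0Sn t; have [_ _ pE] := hp t1.
pose H k w := L t w * a t.+1 k w.
have mH k : measurable_wrt (F t) (H k).
  by apply: measurable_funM; [exact: mL|exact: (ma k t1)].
have mHA k : measurable_fun A (H k).
  by apply: measurable_funTS; exact: filtration_measurable (mH k).
have H0 k w : 0 <= H k w by rewrite mulr_ge0// a_ge0.
have Z0 w : 0 <= (Z t.+1 w)%:R :> R by [].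
have Z1 w : 0 <= 1 - (Z t.+1 w)%:R :> R by case: (Z _ _); rewrite ?subrr ?subr0.
have p0 w : 0 <= p t.+1 w by have /andP[] := p01 w t1.
have p1 w : 0 <= 1 - p t.+1 w by have /andP[_ ?] := p01 w t1; rewrite subr_ge0.
have mZ1 : measurable_fun [set: T] (fun w => 1 - (Z t.+1 w)%:R : R).
  exact: measurable_funB.
have mp1 : measurable_fun [set: T] (fun w => 1 - p t.+1 w).
  exact: measurable_funB.
(* Used twice, with [q] the conditional probability and with [q] the treatment indicator. *)
have split_int (q : T -> R) : measurable_fun [set: T] q ->
  measurable_fun [set: T] (fun w => 1 - q w) ->
  (forall w, 0 <= q w) -> (forall w, 0 <= 1 - q w) ->
  (\int[P]_(w in A) (H true w * q w + H false w * (1 - q w))%:E =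
   \int[P]_(w in A) (H true w * q w)%:E +
   \int[P]_(w in A) (H false w * (1 - q w))%:E)%E.
  move=> mq mq' q0 q0'; under eq_integral do rewrite EFinD.
  apply: ge0_integralD => //.
  - by move=> w _; rewrite lee_fin mulr_ge0.
  - by apply/measurable_EFinP; apply: measurable_funM => //; exact: measurable_funTS.
  - by move=> w _; rewrite lee_fin mulr_ge0.
  - by apply/measurable_EFinP; apply: measurable_funM => //; exact: measurable_funTS.
transitivity (\int[P]_(w in A)
    (H true w * p t.+1 w + H false w * (1 - p t.+1 w))%:E)%E.
  by apply: eq_integral => w _; rewrite /C /H; congr EFin; ring.
transitivity (\int[P]_(w in A)
    (H true w * (Z t.+1 w)%:R + H false w * (1 - (Z t.+1 w)%:R))%:E)%E; last first.
  apply: eq_integral => w _; rewrite LS /H; case: (Z _ _); congr EFin.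
    by rewrite subrr mulr0 mulr1 addr0.
  by rewrite subr0 mulr0 mulr1 add0r.
rewrite !split_int//.
rewrite (integral_mul_sub (sF t) (Fm t) (mH true) (H0 true) (@mpT t) p0 (@mZT t) Z0 pE FA).
by rewrite (integral_mul_sub (sF t) (Fm t) (mH false) (H0 false) mp1 p1 mZ1 Z1
  (fun B FB => esym (integral_compl FB)) FA).
Qed.

(** By induction from the empty product [1]: the integral of [L t.+1] is that of [C t], which is at
    most that of [L t]. *)
Let L_integrable t : P.-integrable [set: T] (EFin \o L t).
Proof.
have [sF Fm _] := hF.
have mLT s : measurable_fun [set: T] (EFin \o L s).
  by apply/measurable_EFinP; exact: filtration_measurable (@mL s).
have mCT s : measurable_fun [set: T] (EFin \o C s).
  by apply/measurable_EFinP; exact: filtration_measurable (@mC s).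
apply/integrableP; split => //.
under eq_integral => w _ do rewrite /= ger0_norm//.
elim: t => [|t IH].
  under eq_integral => w _ do rewrite /L big_geq//.
  by rewrite integral_cst//= mul1e probability_setT ltry.
have FT : F t [set: T].
  by case: (sF t) => F0 FD _; rewrite -[X in F t X]setD0; exact: FD.
rewrite -integral_C//; apply: le_lt_trans IH; apply: ge0_le_integral.
- exact: measurableT.
- by move=> w _; rewrite lee_fin.
- exact: mCT.
- exact: mLT.
- by move=> w _; rewrite lee_fin.
Qed.

Lemma supermartingale_prod :
  supermartingale P F (fun t w => \prod_(1 <= i < t.+1) a i (Z i w) w).
Proof.
split; [exact: mL|exact: L_integrable|].
move=> t; exists (C t); split; last exact/aeW/C_le.
split; [exact: mC| |exact: integral_C].
apply: le_integrable (L_integrable t) => //.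
  by apply/measurable_EFinP; exact: filtration_measurable (@mC t).
by move=> w _; rewrite /= lee_fin !ger0_norm// C_le.
Qed.

End supermartingale_prod.

(** * The exponential inequality for one step *)

(* There is equality at [m = 0], and the derivative in [m] of the difference
   of the two sides is [y^2 m (1 / (1 - m) - 1 / (1 + m y)) >= 0]. *)
Lemma ln1D_ge (R : realType) (m y : R) : 0 <= m < 1 -> -1 <= y ->
  m * y + y ^+ 2 * (ln (1 - m) + m) <= ln (1 + m * y).
Proof.
move=> /andP[m0 m1] y1; rewrite -subr_ge0.
pose g x : R := ln (1 + x * y) - (x * y + y ^+ 2 * (ln (1 - x) + x)).
(* Keeps both logarithms in their domain, and later orders the two reciprocals in the derivative. *)
have pos x : 0 <= x <= m -> 0 < 1 - x /\ 1 - x <= 1 + x * y.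
  by move=> /andP[x0 xm]; split; [lra|nra].
have dg x : 0 <= x <= m -> is_derive x 1 g
    (y ^+ 2 * x * ((1 - x)^-1 - (1 + x * y)^-1)).
  move=> xm; have [p1 p2] := pos _ xm.
  have p3 : 0 < 1 + x * y by exact: lt_le_trans p2.
  have d1 : is_derive x 1 (fun z : R => ln (1 + z * y)) ((1 + x * y)^-1 * y).
    have ? := @is_derive1_ln R _ p3.
    have ? : is_derive x 1 (fun z : R => 1 + z * y) y.
      by apply: is_derive_eq; rewrite /GRing.scale/=; ring.
    exact: (@is_derive1_comp R (@ln R) (fun z : R => 1 + z * y)).
  have d2 : is_derive x 1 (fun z : R => ln (1 - z)) (- (1 - x)^-1).
    have ? := @is_derive1_ln R _ p1.
    have ? : is_derive x 1 (fun z : R => 1 - z) (-1).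
      by apply: is_derive_eq; ring.
    rewrite -mulrN1.
    exact: (@is_derive1_comp R (@ln R) (fun z : R => 1 - z)).
  rewrite /g; apply: is_derive_eq; rewrite /GRing.scale/=; field.
  by rewrite !gt_eqF.
have <- : g 0 = 0 by rewrite /g mul0r !addr0 subr0 ln1 mulr0 addr0 subrr.
apply: (@ger0_derive1_ndecr R g 0 m) => //.
- move=> x; rewrite in_itv/= => /andP[x0 xm].
  by apply: ex_derive; apply: dg; rewrite !ltW.
- move=> x; rewrite in_itv/= => /andP[x0 xm].
  have xm' : 0 <= x <= m by rewrite !ltW.
  have [p1 p2] := pos _ xm'.
  rewrite derive1E (@derive_val _ _ _ _ _ _ _ (dg _ xm')).
  apply: mulr_ge0; first by rewrite mulr_ge0 ?sqr_ge0// ltW.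
  by rewrite subr_ge0 lef_pV2 ?posrE// (lt_le_trans p1).
- apply: derivable_within_continuous => x; rewrite in_itv/= => xm.
  by apply: ex_derive; exact: dg.
Qed.

(** This is the exponential of [ln1D_ge] at [m = c * l] and [y = x / c]; the division by [c ^+ 2] in
    [psiE] comes from the square of [x / c]. *)
Lemma expR_psiE_le (R : realType) (c l x : R) :
  0 < c -> 0 <= l < c^-1 -> - c <= x ->
  expR (l * x - psiE c l * x ^+ 2) <= 1 + l * x.
Proof.
move=> c0 /andP[l0 lc] cx.
have cl1 : c * l < 1 by rewrite mulrC -ltr_pdivlMr// div1r.
have cl0 : 0 <= c * l by rewrite mulr_ge0// ltW.
have cxl : 1 - c * l <= 1 + l * x by nra.
have p0 : 0 < 1 + l * x by lra.
rewrite -[leRHS]lnK ?posrE// ler_expR.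
have := @ln1D_ge R (c * l) (x / c).
rewrite cl0 cl1 ler_pdivlMr// mulN1r cx => /(_ isT isT).
have -> : c * l * (x / c) = l * x by field; rewrite gt_eqF.
apply: le_trans; rewrite /psiE.
by rewrite le_eqVlt; apply/orP; left; apply/eqP; field; rewrite gt_eqF.
Qed.

(** Equals [r true / q] under treatment and [- r false / (1 - q)] under control, for [q] strictly
    between 0 and 1. *)
Definition ipw_residual (R : realType) (q : R) (r : bool -> R) (k : bool) : R :=
  (k%:R - q) / (q * (1 - q)) * r k.

(** The factor that one unit contributes to the exponential process; the sign [s] is [1] or [-1],
    one for each tail. *)
Definition exp_factor (R : realType) (c l s q : R) (r : bool -> R) (k : bool) : R :=
  expR (l * (s * (ipw_residual q r k - (r true - r false)))
        - psiE c l * ipw_residual q r k ^+ 2).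

Lemma ipw_residual_norm_le (R : realType) (m q : R) (r : bool -> R) (k : bool) :
  0 < m -> m <= q <= 1 - m -> (forall b, `|r b| <= 1) ->
  `|ipw_residual q r k| <= m^-1.
Proof.
move=> m0 /andP[mq qm] r1.
have q0 : 0 < q by lra.
have q1 : 0 < 1 - q by lra.
have -> : ipw_residual q r k = r k * (if k then q^-1 else - (1 - q)^-1).
  by rewrite /ipw_residual; case: k => /=; field; rewrite !gt_eqF.
rewrite normrM -[leRHS]mul1r ler_pM//.
by case: k; rewrite ?normrN gtr0_norm ?invr_gt0// lef_pV2 ?posrE//; lra.
Qed.

(* Since [expR (l x - psiE c l x^2) <= 1 + l x], the average is at most
   [(1 + l s e) expR (- l s e)], where [e = r true - r false] is the mean of
   [ipw_residual q r]. *)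
Lemma mean_exp_factor_le1 (R : realType) (c m l s q : R) (r : bool -> R) :
  0 < m -> m^-1 <= c -> 0 <= l < c^-1 -> s ^+ 2 = 1 ->
  m <= q <= 1 - m -> (forall b, `|r b| <= 1) ->
  q * exp_factor c l s q r true + (1 - q) * exp_factor c l s q r false <= 1.
Proof.
move=> m0 mc lc s2 mq r1.
have /andP[mq1 mq2] := mq.
have q0 : 0 < q by lra.
have q1 : 0 < 1 - q by lra.
have c0 : 0 < c by apply: lt_le_trans mc; rewrite invr_gt0.
have s1 : `|s| = 1.
  by move/eqP: s2; rewrite sqrf_eq1 => /orP[] /eqP ->; rewrite ?normrN normr1.
set e := r true - r false.
have bound k : exp_factor c l s q r k <=
    (1 + l * (s * ipw_residual q r k)) * expR (- (l * s * e)).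
  (* Since [s ^+ 2 = 1], the sign can be moved inside the square, and the centering splits off as a
     factor independent of the arm. *)
  have -> : exp_factor c l s q r k = expR (l * (s * ipw_residual q r k)
      - psiE c l * (s * ipw_residual q r k) ^+ 2) * expR (- (l * s * e)).
    by rewrite -expRD; congr expR; rewrite [(s * _) ^+ 2]exprMn s2 /e; ring.
  rewrite ler_wpM2r ?expR_ge0//; apply: expR_psiE_le => //.
  have : `|s * ipw_residual q r k| <= c.
    by rewrite normrM s1 mul1r; apply: le_trans mc; exact: ipw_residual_norm_le.
  by rewrite ler_norml => /andP[].
apply: (@le_trans _ _ ((1 + l * s * e) * expR (- (l * s * e)))); last first.
  rewrite -[leRHS](expRxMexpNx_1 (l * s * e)) ler_wpM2r ?expR_ge0//.
  exact: expR_ge1Dx.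
have -> : 1 + l * s * e = q * (1 + l * (s * ipw_residual q r true)) +
    (1 - q) * (1 + l * (s * ipw_residual q r false)).
  by rewrite /ipw_residual /e /=; field; rewrite !gt_eqF.
by rewrite [leRHS]mulrDl -!(mulrA _ _ (expR _)) lerD// ler_wpM2l// ltW.
Qed.

(** * Clipping to an interval *)

Definition clip (R : realType) (lo hi x : R) : R := Num.min hi (Num.max lo x).

Lemma clip_itv (R : realType) (lo hi x : R) : lo <= hi -> lo <= clip lo hi x <= hi.
Proof. by move=> lohi; rewrite /clip le_min ge_min le_max !lexx lohi. Qed.

Lemma clip_id (R : realType) (lo hi x : R) : lo <= x <= hi -> clip lo hi x = x.
Proof. by move=> /andP[lox xhi]; rewrite /clip (max_idPr lox) (min_idPr xhi). Qed.

Lemma measurable_clip (d : measure_display) (T : measurableType d)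
    (R : realType) (lo hi : R) (f : T -> R) :
  measurable_fun [set: T] f -> measurable_fun [set: T] (fun w => clip lo hi (f w)).
Proof. by move=> mf; apply: measurable_minr => //; exact: measurable_maxr. Qed.

(** * The estimation error as a sub-exponential process *)

Section experiment.
Context (R : realType) (d : measure_display) (T : measurableType d)
  (P : probability T R).
Variables (F : nat -> set (set T)) (Y : nat -> bool -> R) (Z : nat -> T -> bool)
  (p : nat -> T -> R) (Yhat : nat -> bool -> T -> R) (m c : R).
Hypothesis hF : filtration F.
Hypothesis hZ : forall t, (1 <= t)%N -> measurable_wrt (F t) (Z t).
Hypothesis hp : forall t, (1 <= t)%N ->
  is_cond_exp P (F t.-1) (fun w => (Z t w)%:R) (p t).
Hypothesis hYhat : forall t k, (1 <= t)%N -> measurable_wrt (F t.-1) (Yhat t k).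
Hypothesis m_gt0 : 0 < m.
Hypothesis m_le : m <= 2^-1.
Hypothesis hpbnd : forall t, (1 <= t)%N -> {ae P, forall w, m <= p t w <= 1 - m}.
Hypothesis hY01 : forall t k, (1 <= t)%N -> 0 <= Y t k <= 1.
Hypothesis hYhat01 : forall t k, (1 <= t)%N -> {ae P, forall w, 0 <= Yhat t k w <= 1}.
Hypothesis c_ge : m^-1 <= c.

(** This is [t] times the error of [mean_estimate] as an estimate of [ATE]. *)
Definition effect_error (t : nat) (w : T) : R :=
  \sum_(1 <= i < t.+1) (effect_estimate Y Z p Yhat i w - (Y i true - Y i false)).

(** The predictions are a parameter because both the original and the clipped ones are used. *)
Let residual (Yh : nat -> bool -> T -> R) t (w : T) k := Y t k - Yh t k w.

Let effect_estimateE t w :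
  effect_estimate Y Z p Yhat t w - (Y t true - Y t false) =
  ipw_residual (p t w) (residual Yhat t w) (Z t w) -
  (residual Yhat t w true - residual Yhat t w false).
Proof. by rewrite /effect_estimate /ipw /Yobs /ipw_residual /residual; ring. Qed.

Let varianceE t w :
  ipw Z p t w ^+ 2 * (Yobs Y Z t w - Yhat t (Z t w) w) ^+ 2 =
  ipw_residual (p t w) (residual Yhat t w) (Z t w) ^+ 2.
Proof. by rewrite -exprMn. Qed.

Let measurable_ipw_residual (G : set (set T)) (q : T -> R) (r : T -> bool -> R) k :
  measurable_wrt G q -> (forall b, measurable_wrt G (fun w => r w b)) ->
  measurable_wrt G (fun w => ipw_residual (q w) (r w) k).
Proof.
move=> mq mr; apply: measurable_funM; last exact: mr.
apply: measurable_funM; first exact: measurable_funB.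
apply: (measurableT_comp (@measurable_fun_invr R)).
by apply: measurable_funM; [exact: mq|exact: measurable_funB].
Qed.

Let mp t : (1 <= t)%N -> measurable_wrt (F t.-1) (p t).
Proof. by move=> /hp[]. Qed.

Let mresidual Yh t k : (forall k, measurable_wrt (F t.-1) (Yh t k)) ->
  measurable_wrt (F t.-1) (fun w => residual Yh t w k).
Proof. by move=> mYh; apply: measurable_funB; [exact: measurable_cst|exact: mYh]. Qed.

Lemma adapted_effect_error : adapted F effect_error.
Proof.
apply: adapted_sum => // t t1.
under eq_fun do rewrite effect_estimateE.
(* With the arm [k] frozen, the increment is already known at time [t.-1]. *)
pose f k w := ipw_residual (p t w) (residual Yhat t w) k -
  (residual Yhat t w true - residual Yhat t w false).
apply: (@measurable_wrt_if _ _ _ _ _ f); first exact: hZ.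
move=> k; apply: (filtration_wrt_le hF (leq_pred t)).
have mr b : measurable_wrt (F t.-1) (fun w => residual Yhat t w b).
  by apply: mresidual => b'; exact: hYhat.
apply: measurable_funB; last by apply: measurable_funB; exact: mr.
by apply: measurable_ipw_residual => //; exact: mp.
Qed.

Lemma adapted_variance_process : adapted F (variance_process Y Z p Yhat).
Proof.
apply: adapted_sum => // t t1.
under eq_fun do rewrite varianceE.
pose f k w := ipw_residual (p t w) (residual Yhat t w) k ^+ 2.
apply: (@measurable_wrt_if _ _ _ _ _ f); first exact: hZ.
move=> k; apply: (filtration_wrt_le hF (leq_pred t)).
apply: measurable_funX; apply: measurable_ipw_residual; first exact: mp.
by move=> b; apply: mresidual => b'; exact: hYhat.
Qed.

(* The bounds on [p] and [Yhat] hold only almost surely, whereas the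
   supermartingale has to be nonnegative and contracting everywhere; it is
   therefore built from clipped versions. *)
Let q t w := clip m (1 - m) (p t w).
Let Yh t k w := clip 0 1 (Yhat t k w).

Let m_le1m : m <= 1 - m. Proof. by have := m_le; lra. Qed.

(** Clipping changes [p t] only on a null set, hence changes none of its integrals, and it preserves
    measurability. *)
Let q_cond_exp t : (1 <= t)%N -> is_cond_exp P (F t.-1) (fun w => (Z t w)%:R) (q t).
Proof.
move=> t1; have [mpt pint pE] := hp t1; have [sF Fm _] := hF.
have mq : measurable_wrt (F t.-1) (q t) by exact: measurable_clip.
have mqT : measurable_fun [set: T] (q t) by exact: (filtration_measurable hF mq).
have mpT : measurable_fun [set: T] (p t) by exact: (filtration_measurable hF mpt).
split => //.
  have i1 : P.-integrable [set: T] (EFin \o cst (1 : R)).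
    exact: finite_measure_integrable_cst.
  apply: (le_integrable measurableT _ _ i1); first exact/measurable_EFinP.
  move=> w _; rewrite /= lee_fin normr1.
  have /andP[q1 q2] := clip_itv (p t w) m_le1m.
  by rewrite /q ger0_norm; have := m_gt0; lra.
move=> A FA; rewrite -pE//; have mA := Fm _ _ FA.
apply: ae_eq_integral => //.
- by apply/measurable_EFinP; exact: measurable_funTS.
- by apply/measurable_EFinP; exact: measurable_funTS.
- by apply: filterS (hpbnd t1) => w pw _; rewrite /q clip_id.
Qed.

(** The dominating supermartingale is the product of the clipped factors. Almost surely no clipping
    takes place, and the required inequality is then an equality. *)
Lemma sub_psi_effect_error (s : R) : s ^+ 2 = 1 ->
  sub_psi P F (c^-1)%:E (psiE c) 1 (fun t w => s * effect_error t w)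
    (variance_process Y Z p Yhat).
Proof.
move=> s2; split.
- by move=> t; apply: measurable_funM; [exact: measurable_cst|exact: adapted_effect_error].
- exact: adapted_variance_process.
- by move=> w; rewrite /effect_error /variance_process !big_geq// mulr0.
- by move=> t w; apply: sumr_ge0 => i _; rewrite mulr_ge0 ?sqr_ge0.
move=> l l0; rewrite lte_fin => lc.
pose a t k w := exp_factor c l s (q t w) (residual Yh t w) k.
exists (fun t w => \prod_(1 <= i < t.+1) a i (Z i w) w); split.
- apply: (@supermartingale_prod _ _ _ _ _ _ q) => //.
  + move=> t w _; have /andP[q1 q2] := clip_itv (p t w) m_le1m.
    by rewrite /q; have := m_gt0; lra.
  + move=> t k t1.
    have mq : measurable_wrt (F t.-1) (q t) by apply: measurable_clip; exact: mp.
    have mr b : measurable_wrt (F t.-1) (fun w => residual Yh t w b).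
      by apply: mresidual => b'; apply: measurable_clip; exact: hYhat.
    apply: (measurableT_comp (@measurable_expR R)).
    apply: measurable_funB; last first.
      apply: measurable_funM => //; apply: measurable_funX.
      exact: measurable_ipw_residual.
    apply: measurable_funM => //; apply: measurable_funM => //.
    apply: measurable_funB; last by apply: measurable_funB; exact: mr.
    exact: measurable_ipw_residual.
  + by move=> t k w _; exact: expR_ge0.
  + move=> t w t1; apply: (@mean_exp_factor_le1 _ c m) => //.
    * by rewrite l0.
    * exact: clip_itv.
    * move=> b; have /andP[y0 y1] := hY01 b t1.
      have /andP[h0 h1] := clip_itv (Yhat t b w) (@ler01 R).
      by rewrite ler_norml /residual /Yh; lra.
(* At time 0 the product is empty, so its expectation is exactly [1]. *)
- under eq_fun do rewrite big_geq//.
  by rewrite (expectation_cst P 1).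
move=> t.
(* There are countably many almost sure bounds, so one null set serves all factors. *)
have : {ae P, forall w, forall i, (1 <= i)%N -> [/\ m <= p i w <= 1 - m,
    0 <= Yhat i true w <= 1 & 0 <= Yhat i false w <= 1]}.
  apply: ae_foralln => i; case: (leqP 1 i) => i1; last exact: aeW.
  apply: filterS3 (hpbnd i1) (hYhat01 true i1) (hYhat01 false i1).
  by move=> w.
apply: filterS => w ok.
rewrite /effect_error /variance_process !mulr_sumr -sumrB expR_sum.
rewrite le_eqVlt; apply/orP; left; apply/eqP.
apply: eq_big_nat => i /andP[i1 _].
have [okp ok1 ok0] := ok i i1.
rewrite effect_estimateE varianceE /a /exp_factor.
have -> : q i w = p i w by rewrite /q clip_id.
by have -> : residual Yh i w = residual Yhat i w
  by apply/funext => -[]; rewrite /residual /Yh clip_id.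
Qed.

End experiment.

(** * Crossing events and the union bound *)

Lemma measurable_crossing (R : realType) (d : measure_display)
    (T : measurableType d) (u : R -> R) (S V : nat -> T -> R) :
  measurable_fun (`[0, +oo[ : set R) u ->
  (forall t, measurable_fun [set: T] (S t)) ->
  (forall t, measurable_fun [set: T] (V t)) -> (forall t w, 0 <= V t w) ->
  measurable [set w | exists t, (1 <= t)%N /\ u (V t w) <= S t w].
Proof.
move=> mu mS mV V0.
rewrite (_ : [set _ | _] =
    \bigcup_t [set w | (1 <= t)%N && (u (V t w) <= S t w)]); last first.
  apply/seteqP; split => w /= [t].
    by move=> [t1 ut]; exists t => //=; rewrite t1.
  by move=> _ /= /andP[]; exists t.
apply: bigcup_measurable => t _; case: (leqP 1 t) => t1 /=; last first.
  by rewrite (_ : [set _ | _] = set0)//; apply/seteqP; split.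
(* [u] is measurable on the nonnegative half-line, which contains the range of [V t]. *)
have muV : measurable_fun [set: T] (fun w => u (V t w)).
  apply: (measurable_comp _ _ mu (mV t)) => //.
  by move=> _ [w _ <-] /=; rewrite in_itv/= V0.
have mle := measurable_fun_ler muV (mS t).
by have := @mle measurableT [set true]; rewrite setTI; apply.
Qed.

Unset Implicit Arguments.
Set Strict Implicit.

Theorem corollary2 (R : realType) (d : measure_display) (T : measurableType d)
    (P : probability T R) (F : nat -> set (set T))
    (Y : nat -> bool -> R) (Z : nat -> T -> bool) (p : nat -> T -> R)
    (Yhat : nat -> bool -> T -> R)
    (pmin alpha : R) (u : R -> R)
    (hF : filtration F)
    (hZ : forall t, (1 <= t)%N -> measurable_wrt (F t) (Z t))
    (hp : forall t, (1 <= t)%N ->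
       is_cond_exp P (F t.-1) (fun w => (Z t w)%:R) (p t))
    (hp01 : forall t, (1 <= t)%N -> {ae P, forall w, 0 < p t w < 1})
    (hYhat : forall t k, (1 <= t)%N -> measurable_wrt (F t.-1) (Yhat t k))
    (hpmin : 0 < pmin <= 2^-1)
    (hpbnd : forall t, (1 <= t)%N ->
       {ae P, forall w, pmin <= p t w <= 1 - pmin})
    (hY01 : forall t k, (1 <= t)%N -> 0 <= Y t k <= 1)
    (hYhat01 : forall t k, (1 <= t)%N ->
       {ae P, forall w, 0 <= Yhat t k w <= 1})
    (halpha : 0 < alpha < 1)
    (hu : sub_exponential_boundary (2 / pmin) alpha u) :
  ((1 - 2 * alpha)%:E <=
   P [set w | forall t, (1 <= t)%N ->
        (`|mean_estimate Y Z p Yhat t w - ATE Y t|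
           < u (variance_process Y Z p Yhat t w) / t%:R)%R])%E.
Proof.
have /andP[m0 m1] := hpmin.
have [_ [mu hcross]] := hu.
(* The bound on the weighted residuals lies within the scale of the boundary. *)
have mc : pmin^-1 <= 2 / pmin.
  by rewrite -[leLHS]mul1r ler_wpM2r ?invr_ge0 ?ltW// ltrDl.
pose S := effect_error Y Z p Yhat.
pose V := variance_process Y Z p Yhat.
(* [A 1] is the crossing by the error, [A (-1)] the crossing by its negative. *)
pose A s := [set w | exists t, (1 <= t)%N /\ u (V t w) <= s * S t w].
have PA s : s ^+ 2 = 1 -> (P (A s) <= alpha%:E)%E.
  by move=> s2; apply: (hcross _ _ P F (fun t w => s * S t w)) => //;
    apply: (sub_psi_effect_error hF hZ hp hYhat m0 m1 hpbnd hY01 hYhat01 mc s2).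
have mA s : measurable (A s).
  apply: measurable_crossing => // t.
  - apply: measurable_funM => //.
    have mS : adapted F S := adapted_effect_error Y hF hZ hp hYhat.
    exact: (filtration_measurable hF (@mS t)).
  - have mV : adapted F V := adapted_variance_process Y hF hZ hp hYhat.
    exact: (filtration_measurable hF (@mV t)).
  - by move=> w; apply: sumr_ge0 => i _; rewrite mulr_ge0 ?sqr_ge0.
(* Multiplying by [t], positive as [t] starts at 1, turns the bound on the mean into [S t] lying
   strictly between [- u] and [u]; this fails at some [t] exactly when one of the crossings
   occurs. *)
rewrite (_ : [set _ | _] = ~` (A 1 `|` A (-1))); last first.
  have errE t w : (1 <= t)%N -> (`|mean_estimate Y Z p Yhat t w - ATE Y t|
      < u (V t w) / t%:R) = (`|S t w| < u (V t w)).
    move=> t1; have t0 : 0 < t%:R :> R by rewrite ltr0n.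
    rewrite /mean_estimate /ATE -mulrBr -sumrB normrM ger0_norm ?invr_ge0 ?ltW//.
    by rewrite mulrC ltr_pM2r ?invr_gt0.
  apply/seteqP; split => w /=.
    move=> ok [|] [t [t1]]; have := ok t t1; rewrite errE// ltr_norml.
      by move=> /andP[_ h]; rewrite mul1r leNgt h.
    by move=> /andP[h _]; rewrite mulN1r lerNr leNgt h.
  move=> ok t t1; rewrite errE// ltr_norml ltrNl -mulN1r.
  rewrite -[X in _ && (X < _)]mul1r.
  apply/andP; split; rewrite ltNge; apply/negP => h; apply: ok.
    by right; exists t.
  by left; exists t.
rewrite probability_setC; last exact: measurableU.
rewrite EFinB leeB//.
apply: (le_trans (measureU2 _ _ _)) => //.
by rewrite mulrDl mul1r EFinD leeD// PA// ?expr1n// sqrrN expr1n.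
Qed.
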